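(* Let $C \ne 0$ be a linear code of length $n$, dimension $k$ and minimum distance $d$ over $\mathbb{F}_q$, and let $g = n+1-k-d$. Let $a(t)$ be its normalized weight enumerator, $Z(T)$ its one-variable zeta function and $Z(T,u)$ its two-variable zeta function (all defined in the context). Then the two-variable zeta function is compatible with the one-variable zeta function, such that $$Z(T,q)=Z(T).$$ Namely, as formal power series in $t$, $$a(t)(1+t)^{d+1} \equiv Z\!\left(\frac{t}{1+t},q\right) \pmod{t^{n+1-d}},$$ which after the substitution $t=T/(1-T)$ agrees with the congruence defining the one-variable zeta function.
   Context: $\mathbb{F}_q$ is the finite field with $q$ elements, and a linear code of length $n$ and dimension $k$ is a $k$-dimensional linear subspace $C\subseteq \mathbb{F}_q^n$. Its minimum distance $d$ is the smallest weight (number of nonzero coordinates) of a nonzero codeword. $A_w$ is the number of codewords of weight $w$, $a_w = A_w/\binom{n}{w}$, and the normalized weight enumerator is $$a(t)=\frac{1}{q-1}\left(a_d+a_{d+1}t+\cdots+a_nt^{n-d}\right).$$ One-variable zeta function: let $P(T)$ be the unique polynomial of degree at most $n-d$ such that $\frac{P(T)}{(1-T)(1-qT)}(1-T)^{d+1}\equiv a\!\left(\frac{T}{1-T}\right) \pmod{T^{n-d+1}}$. The zeta function of $C$ is $Z(T)=\frac{P(T)}{(1-T)(1-qT)}$. Two-variable zeta function: let $G$ be the family of the $n$ columns (indexed by $\{1,\ldots,n\}$) of a $k\times n$ generator matrix of $C$. For a subfamily $A\subseteq G$ let $|A|$ be its number of columns and $r(A)$ the dimension of its linear span; thus $r(G)=k$.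 Define the normalized rank-generating polynomial $$W_n(x,y)=\sum_{i=0}^n\frac{1}{\binom ni}\sum_{A\subseteq G,\ |A|=i}x^{r(G)-r(A)}y^{|A|-r(A)}$$ and the rational function $$W_n^+(x,y)=W_n(x,y)+\frac{x^{k+1}}{1-x}+\frac{y^{n-k+1}}{1-y}.$$ The two-variable zeta function of $C$ is the rational function $Z(T,u)$ in $T$ and $u$ determined by $$Z(T,u)\,(u-1)\,T^{1-g}=W_n^+(uT,T^{-1}).$$
   Formalization: The equality Z(T,q)=Z(T) is stated only for codes with no identically zero coordinate (no zero column in the generator matrix), since it fails otherwise (e.g. n=2, generator [1 0]); both congruences are stated for all C≠0. *)

(* Defs.v *)
From HB Require Import structures.
From mathcomp Require Import all_boot all_order all_algebra.
From mathcomp Require Import boolp ring.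

Set Implicit Arguments.
Unset Strict Implicit.
Unset Printing Implicit Defensive.

Import GRing.Theory Num.Theory FracField.

Local Open Scope ring_scope.

Notation "x %:F" := (@tofrac _ x) : ring_scope.

(* The field Q(T) of rational functions in one variable, the inclusion of the *)
(* constants, and the field Q(T)(u) = Q(T, u).                                *)
Notation ratfun1 := {fraction {poly rat}}.
Notation ratfun2 := {fraction {poly ratfun1}}.

Definition ratfun1_const : {rmorphism rat -> ratfun1} :=
  (@tofrac {poly rat} \o @polyC rat).

(* The value at c of a rational function over K, whose coefficients are sent  *)
(* to L by phi. The fraction is put in lowest terms first, so the value is    *)
(* the right one whenever c is not a pole (see ratfun_evalE); it is 0 at a    *)
(* pole.                                                                      *)
Definition ratfun_eval (K L : fieldType) (phi : {rmorphism K -> L})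
    (f : {fraction {poly K}}) (c : L) : L :=
  let N := \n_(repr f) in
  let D := \d_(repr f) in
  let G := gcdp N D in
  (map_poly phi (N %/ G)).[c] / (map_poly phi (D %/ G)).[c].

(* f(h) *)
Definition ratfun_subst (f h : ratfun1) : ratfun1 :=
  ratfun_eval ratfun1_const f h.

(* Z(T, c), for a rational function Z(T, u) in T and u and a constant c. *)
Definition ratfun_at_u (Z : ratfun2) (c : rat) : ratfun1 :=
  ratfun_eval (idfun : {rmorphism ratfun1 -> ratfun1}) Z (ratfun1_const c).

(* The formal power series \sum_i s_i T^i is the expansion of the rational    *)
(* function f: f = A / B with B(0) != 0, and B * s = A as power series.       *)
Definition fps_expansion (f : ratfun1) (s : nat -> rat) : Prop :=
  exists A B : {poly rat},
    [/\ B`_0 != 0, f = A%:F / B%:F &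
        forall i, \sum_(j < i.+1) B`_j * s (i - j)%N = A`_i].

(* f = g (mod T^m) as formal power series. *)
Definition fps_eqmod (m : nat) (f g : ratfun1) : Prop :=
  exists sf sg : nat -> rat,
    [/\ fps_expansion f sf, fps_expansion g sg &
        forall i, (i < m)%N -> sf i = sg i].

Section Codes.

Variables (F : finFieldType) (n : nat).
Implicit Type C : {vspace 'rV[F]_n}.

Definition wt (v : 'rV[F]_n) : nat := #|[set i | v 0 i != 0]|.

(* The bound n on every weight makes this the minimum as soon as C != 0. *)
Definition min_distance C : nat :=
  \big[minn/n]_(v : 'rV[F]_n | (v \in C) && (v != 0)) wt v.

Definition wt_count C (w : nat) : nat :=
  #|[set v : 'rV[F]_n | (v \in C) && (wt v == w)]|.

Definition norm_wt_enum C : {poly rat} :=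
  (#|F|%:R - 1)^-1 *:
    \poly_(i < (n - min_distance C).+1)
      ((wt_count C (min_distance C + i))%:R /
       'C(n, min_distance C + i)%:R).

Definition is_zeta_poly C (P : {poly rat}) : Prop :=
  let d := min_distance C in
  let T : ratfun1 := 'X%:F in
  (size P <= (n - d).+1)%N /\
  fps_eqmod (n - d).+1
    (P%:F / ((1 - T) * (1 - #|F|%:R * T)) * (1 - T) ^+ d.+1)
    (ratfun_subst (norm_wt_enum C)%:F (T / (1 - T))).

Definition is_generator_matrix C k (M : 'M[F]_(k, n)) : Prop :=
  basis_of C [seq row i M | i : 'I_k].

Definition col_rank k (M : 'M[F]_(k, n)) (A : {set 'I_n}) : nat :=
  \dim <<[seq col j M | j in A]>>.

(* The polynomial W_n and the rational function W_n^+ are given by their       *)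
(* values at x, y in any field K; zeta2 takes K = Q(T, u).                    *)
Definition norm_rank_gen k (M : 'M[F]_(k, n)) (K : fieldType) (x y : K) : K :=
  \sum_(i < n.+1) ('C(n, i)%:R)^-1 *
    \sum_(A : {set 'I_n} | #|A| == i)
      x ^+ (col_rank M [set: 'I_n] - col_rank M A) *
      y ^+ (#|A| - col_rank M A).

Definition norm_rank_gen_plus k (M : 'M[F]_(k, n)) (K : fieldType)
    (x y : K) : K :=
  norm_rank_gen M x y + x ^+ k.+1 / (1 - x) + y ^+ (n - k).+1 / (1 - y).

Definition zeta2 C k (M : 'M[F]_(k, n)) : ratfun2 :=
  let g : int := n%:Z + 1 - k%:Z - (min_distance C)%:Z in
  let T : ratfun2 := 'X%:F%:P%:F in
  let u : ratfun2 := 'X%:F in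
  norm_rank_gen_plus M (u * T) T^-1 / ((u - 1) * T ^ (1 - g)).

End Codes.

Lemma ratfun_reprE (K : fieldType) (f : {fraction {poly K}}) :
  f = (\n_(repr f))%:F / (\d_(repr f))%:F.
Proof.
rewrite -{1}[f]reprK; case: (repr f) => -[N D] /= D0.
rewrite -[X in _ = X]/(mul _ (inv _)) !piE; apply/eqmodP => /=.
rewrite FracField.equivfE /mulf /invf /=.
rewrite !numden_Ratio ?oner_eq0 // ?mul1r ?mulr1 //.
  by rewrite mulrC.
Qed.

Lemma ratfun_evalE (K L : fieldType) (phi : {rmorphism K -> L})
    (A B : {poly K}) (c : L) :
  (map_poly phi B).[c] != 0 ->
  ratfun_eval phi (A%:F / B%:F) c =
  (map_poly phi A).[c] / (map_poly phi B).[c].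
Proof.
move=> Bc; rewrite /ratfun_eval.
have B0 : B != 0 by apply: contraNneq Bc => ->; rewrite rmorph0 horner0.
have := ratfun_reprE (A%:F / B%:F).
set N := \n_ _; set D := \d_ _.
have D0 : D != 0 by exact: denom_ratioP.
move=> /eqP; rewrite eqr_div ?tofrac_eq0 // -!rmorphM tofrac_eq => /eqP e.
set G := gcdp N D.
have G0 : G != 0 by rewrite gcdp_eq0 (negPf D0) andbF.
have eN : N = N %/ G * G by rewrite divpK ?dvdp_gcdl.
have eD : D = D %/ G * G by rewrite divpK ?dvdp_gcdr.
have cop : coprimep (D %/ G) (N %/ G).
  by rewrite coprimep_sym coprimep_div_gcd // D0 orbT.
move: eN eD cop; set N' := N %/ G; set D' := D %/ G => eN eD cop.
have e' : A * D' = N' * B.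
  by apply: (mulIf G0); rewrite -mulrA -eD e {1}eN mulrAC.
have /dvdpP[E eB] : D' %| B.
  by rewrite -(Gauss_dvdpr _ cop) -e' dvdp_mull.
have D'0 : D' != 0 by apply: contraNneq D0; rewrite eD => ->; rewrite mul0r.
have eA : A = N' * E.
  by apply: (mulIf D'0); rewrite e' eB mulrA.
move: Bc; rewrite eA eB !rmorphM !hornerM mulf_eq0 negb_or => /andP[Ec Dc].
by rewrite [X in _ = _ / X]mulrC -mulf_div divff // mulr1.
Qed.

Lemma fps_expansion_exists (A B : {poly rat}) : B`_0 != 0 ->
  exists s : nat -> rat,
    forall i, \sum_(j < i.+1) B`_j * s (i - j)%N = A`_i.
Proof.
move=> B0.
pose nxt (l : seq rat) :=
  (A`_(size l) - \sum_(j < size l) B`_j.+1 * l`_(size l - j.+1)) / B`_0.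
pose bld := fix bld m := if m is m'.+1 then rcons (bld m') (nxt (bld m'))
                         else [::].
have szb m : size (bld m) = m by elim: m => //= m IH; rewrite size_rcons IH.
have nb m p i : (i < m <= p)%N -> (bld p)`_i = (bld m)`_i.
  case/andP=> im; elim: p => [|p IH]; first by rewrite leqn0 => /eqP mE; rewrite mE in im.
  rewrite leq_eqVlt => /predU1P[->//|]; rewrite ltnS => mp.
  by rewrite /= nth_rcons szb (leq_trans im mp) IH.
exists (fun i => (bld i.+1)`_i) => i.
rewrite big_ord_recl subn0 /= nth_rcons szb ltnn eqxx /nxt szb.
rewrite mulrC divfK //; set S := (X in _ - X + _).
rewrite [X in _ + X](_ : _ = S) ?subrK //; apply: eq_bigr => j _.
rewrite /bump /= add1n; congr (_ * _).
rewrite -[rcons _ _]/(bld (i - j.+1).+1) [RHS](nb (i - j.+1).+1) //.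
by rewrite ltnSn /= subnSK // leq_subr.
Qed.

Lemma fps_expansion_poly m (A B : {poly rat}) (s : nat -> rat) :
  (forall i, \sum_(j < i.+1) B`_j * s (i - j)%N = A`_i) ->
  'X^m %| A - B * \poly_(i < m) s i.
Proof.
move=> e; apply/dvdpP; exists (drop_poly m (A - B * \poly_(i < m) s i)).
rewrite -[LHS](poly_take_drop m) [X in X + _](_ : _ = 0) ?add0r //.
apply/polyP => i; rewrite coef_take_poly coef0; case: ltnP => // im.
rewrite coefB coefM -e -sumrB big1 // => j _.
by rewrite coef_poly (leq_ltn_trans (leq_subr _ _) im) subrr.
Qed.

Lemma coprimep_Xn m (B : {poly rat}) : B`_0 != 0 -> coprimep 'X^m B.
Proof.
move=> B0; rewrite coprimep_sym coprimep_expr //.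
by rewrite coprimepX /root horner_coef0.
Qed.

Lemma fps_eqmodP m (A1 B1 A2 B2 : {poly rat}) : B1`_0 != 0 -> B2`_0 != 0 ->
  'X^m %| A1 * B2 - A2 * B1 <->
  fps_eqmod m (A1%:F / B1%:F) (A2%:F / B2%:F).
Proof.
move=> B10 B20.
have nz (B : {poly rat}) : B`_0 != 0 -> B != 0.
  by apply: contraNneq => ->; rewrite coef0.
split=> [dv|[s1 [s2 [[A1' [B1' [B10' e1 E1]]] [A2' [B2' [B20' e2 E2]]] es]]]].
  have [s1 E1] := fps_expansion_exists A1 B10.
  have [s2 E2] := fps_expansion_exists A2 B20.
  exists s1, s2; split; [by exists A1, B1|by exists A2, B2|].
  have D1 := fps_expansion_poly m E1; have D2 := fps_expansion_poly m E2.
  have D : 'X^m %| (B1 * B2) * (\poly_(i < m) s1 i - \poly_(i < m) s2 i).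
    set S1 := \poly_(i < m) s1 i in D1 *; set S2 := \poly_(i < m) s2 i in D2 *.
    have -> : (B1 * B2) * (S1 - S2) =
      (A1 * B2 - A2 * B1) - B2 * (A1 - B1 * S1) + B1 * (A2 - B2 * S2) by ring.
    by apply: dvdp_add (dvdp_sub dv _) _; apply: dvdp_mull.
  have cB : coprimep 'X^m (B1 * B2) by apply: coprimep_Xn; rewrite coef0M mulf_neq0.
  move: D; rewrite (Gauss_dvdpr _ cB) => D i im.
  have : \poly_(i < m) s1 i - \poly_(i < m) s2 i = 0.
    apply: contraTeq D => Dn0; apply: contraL Dn0 => /dvdp_leq H.
    apply/negPn; apply: contraT => /H; rewrite size_polyXn ltnNge => /negP[].
    by rewrite (leq_trans (size_polyD _ _)) // size_polyN geq_max !size_poly.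
  by move=> /polyP/(_ i); rewrite coefB !coef_poly im coef0 => /eqP; rewrite subr_eq0 => /eqP.
have D1 := fps_expansion_poly m E1; have D2 := fps_expansion_poly m E2.
have eS : \poly_(i < m) s1 i = \poly_(i < m) s2 i.
  by apply/polyP => i; rewrite !coef_poly; case: ltnP => // /es.
rewrite -eS in D2; set S := \poly_(i < m) s1 i in D1 D2.
have /eqP := e1; rewrite eqr_div ?tofrac_eq0 ?nz //.
rewrite -!rmorphM tofrac_eq => /eqP {}e1.
have /eqP := e2; rewrite eqr_div ?tofrac_eq0 ?nz //.
rewrite -!rmorphM tofrac_eq => /eqP {}e2.
have c : coprimep 'X^m (B1' * B2') by apply: coprimep_Xn; rewrite coef0M mulf_neq0.
rewrite -(Gauss_dvdpr _ c).
have -> : B1' * B2' * (A1 * B2 - A2 * B1) =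
   B1 * B2 * (B2' * (A1' - B1' * S) - B1' * (A2' - B2' * S)).
  transitivity ((A1 * B1') * (B2' * B2) - (A2 * B2') * (B1' * B1));
    first by ring.
  by rewrite e1 e2; ring.
by rewrite dvdp_mull // dvdp_sub // dvdp_mull.
Qed.

Lemma ratfun_subst_poly (a : {poly rat}) (h : ratfun1) :
  ratfun_subst a%:F h = (map_poly ratfun1_const a).[h].
Proof.
rewrite /ratfun_subst -[a%:F]divr1 -(rmorph1 (@tofrac {poly rat})).
by rewrite ratfun_evalE rmorph1 hornerE ?divr1 ?oner_neq0.
Qed.

Lemma poly_solve_mod (D U R : {poly rat}) : D != 0 -> coprimep D U ->
  exists! P : {poly rat}, (size P < size D)%N /\ D %| P * U - R.
Proof.
move=> D0 cDU; have /Bezout_eq1_coprimepP[[u v] /= e] := cDU.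
exists ((v * R) %% D); set Q := _ %% D.
have sQ : (size Q < size D)%N by rewrite ltn_modp.
have dQ : D %| Q * U - R.
  have -> : Q * U - R = - ((v * R) %/ D * U + u * R) * D.
    have -> : Q = v * R - (v * R) %/ D * D.
      by rewrite {1}(divp_eq (v * R) D) -/Q addrAC subrr add0r.
    by rewrite -[in X in _ - X = _](mul1r R) -e; ring.
  exact: dvdp_mull (dvdpp _).
split=> // P [sP dP].
apply/eqP; rewrite -subr_eq0; apply: contraT => QP0.
have : D %| U * (Q - P).
  have -> : U * (Q - P) = (Q * U - R) - (P * U - R) by ring.
  exact: dvdp_sub.
rewrite (Gauss_dvdpr _ cDU) => /dvdp_leq-/(_ QP0).
by rewrite leqNgt (leq_ltn_trans (size_polyD _ _)) // size_polyN gtn_max sQ.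
Qed.

Lemma div_mul_cancel1 (K : fieldType) (x y z : K) k :
  y != 0 -> x / (y * z) * y ^+ k.+1 = x * y ^+ k / z.
Proof.
move=> y0; rewrite exprS invfM -!mulrA; congr (x * _).
by rewrite [z^-1 * _]mulrC -mulrA mulKf.
Qed.

Lemma expr_div_subn (K : fieldType) (x y : K) (i m : nat) :
  y != 0 -> (i <= m)%N -> (x / y) ^+ i = x ^+ i * y ^+ (m - i) / y ^+ m.
Proof.
move=> y0 im; rewrite -[in y ^- m](subnK im) exprD invfM.
by rewrite expr_div_n mulrA mulfK // expf_neq0.
Qed.

Section ZetaPoly.

Variables (F : finFieldType) (n : nat).
Implicit Type C : {vspace 'rV[F]_n}.

Lemma is_zeta_polyP C (P : {poly rat}) :
  let d := min_distance C in
  let m := (n - d)%N in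
  let a := norm_wt_enum C in
  is_zeta_poly C P <->
  (size P <= m.+1)%N /\
  'X^(m.+1) %| P * (1 - 'X) ^+ (d + m) -
    (\sum_(i < m.+1) a`_i *: ('X^i * (1 - 'X) ^+ (m - i))) *
    (1 - #|F|%:R * 'X).
Proof.
move=> d m a; rewrite /is_zeta_poly -/d -/m -/a.
set q : rat := #|F|%:R.
have c1 k : ((1 - 'X : {poly rat}) ^+ k)`_0 != 0.
  by rewrite -horner_coef0 horner_exp !hornerE ?subr0 expr1n ?oner_neq0.
have cq : (1 - #|F|%:R * 'X : {poly rat})`_0 != 0.
  by rewrite coefB coef1 coefMX eqxx subr0 oner_neq0.
have nz (B : {poly rat}) : B`_0 != 0 -> B != 0.
  by apply: contraNneq => ->; rewrite coef0.
set N := \sum_(i < m.+1) _.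
have e1 : 1 - 'X%:F = (1 - 'X : {poly rat})%:F by rewrite rmorphB rmorph1.
have e2 : 1 - #|F|%:R * 'X%:F = (1 - #|F|%:R * 'X : {poly rat})%:F.
  by rewrite rmorphB rmorph1 rmorphM rmorph_nat.
have X0 : (1 - 'X : {poly rat})%:F != 0.
  by rewrite tofrac_eq0 nz // -(expr1 (1 - 'X)).
have X1 : 1 - 'X%:F != 0 :> ratfun1 by rewrite e1.
have -> : P%:F / ((1 - 'X%:F) * (1 - #|F|%:R * 'X%:F)) * (1 - 'X%:F) ^+ d.+1 =
    (P * (1 - 'X) ^+ d)%:F / (1 - #|F|%:R * 'X)%:F.
  by rewrite (div_mul_cancel1 _ _ _ X1) e1 e2 rmorphM rmorphXn.
have -> : ratfun_subst a%:F ('X%:F / (1 - 'X%:F)) =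
    N%:F / ((1 - 'X) ^+ m)%:F.
  rewrite ratfun_subst_poly (@horner_coef_wide _ m.+1); last first.
    by rewrite (leq_trans (size_poly _ _)) // /a (leq_trans (size_scale_leq _ _)) // size_poly.
  rewrite rmorph_sum /= mulr_suml; apply: eq_bigr => i _.
  have im : (i <= m)%N by rewrite -ltnS.
  rewrite coef_map (expr_div_subn _ X1 im) -mul_polyC !rmorphM !rmorphXn /=.
  by rewrite !mulrA e1.
rewrite -fps_eqmodP ?c1 ?cq // exprD mulrA; tauto.
Qed.

Lemma zeta_poly_exists_unique C : exists! P : {poly rat}, is_zeta_poly C P.
Proof.
have D0 : 'X^((n - min_distance C).+1) != 0 :> {poly rat}.
  by rewrite -size_poly_eq0 size_polyXn.
have [P [hP uP]] := poly_solve_mod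
  ((\sum_(i < (n - min_distance C).+1) (norm_wt_enum C)`_i *:
      ('X^i * (1 - 'X) ^+ (n - min_distance C - i))) * (1 - #|F|%:R * 'X)) D0
  (@coprimep_Xn (n - min_distance C).+1
     ((1 - 'X) ^+ (min_distance C + (n - min_distance C)))
     ltac:(by rewrite -horner_coef0 horner_exp !hornerE ?subr0 expr1n ?oner_neq0)).
rewrite size_polyXn ltnS in hP.
exists P; split; first exact/is_zeta_polyP.
by move=> P' /is_zeta_polyP hP'; apply: uP; rewrite size_polyXn ltnS.
Qed.

Lemma zeta_poly_exists C : exists P : {poly rat}, is_zeta_poly C P.
Proof. by have [P []] := zeta_poly_exists_unique C; exists P. Qed.

Definition zeta_poly C : {poly rat} := sval (cid (zeta_poly_exists C)).

Definition zeta1 C : ratfun1 :=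
  let T : ratfun1 := 'X%:F in
  (zeta_poly C)%:F / ((1 - T) * (1 - #|F|%:R * T)).

End ZetaPoly.

(* Main.v *)
Require Import Defs.
From mathcomp Require Import all_boot all_order all_algebra.
From mathcomp Require Import boolp mxabelem finfield ring zify.

Set Implicit Arguments.
Unset Strict Implicit.
Unset Printing Implicit Defensive.

Import GRing.Theory Num.Theory.
Local Open Scope ring_scope.

(* Exactly q^(k - r(A)) codewords vanish on a set A of coordinates. Counting  *)
(* the pairs (codeword, set of size i on which it vanishes) in two ways, the  *)
(* mean of q^(k - r(A)) over |A| = i is 1 + (q - 1) gam_(n - i), where        *)
(* gam_l = \sum_w a_w binomial(l, w) / (q - 1) vanishes for l < d. Hence      *)
(* Z(T, q) has the coefficients gam_(d + j) for j <= m = n - d, followed by   *)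
(* (q^(k + j - m) - 1) / (q - 1) for j > m. Both congruences reduce to the    *)
(* negative binomial expansion (1 - T)^-(w + 1) = \sum_l binomial(w + l, l)   *)
(* T^l, homogenised so that it can be evaluated at T and at t / (1 + t). If   *)
(* no column of M is 0, then r(A) = 1 for |A| = 1, so the closed form of the  *)
(* tail already holds at j = m - 1 and j = m, and the numerator of Z(T, q)    *)
(* has degree at most n - d: it is the zeta polynomial.                       *)

(** * Truncated negative binomial expansion *)

(** At [x = q T], [y = T^-1] the monomial of a set [A] is q^(k - r(A)) T^(k - |A|), so [W_n] only
    sees the mean over |A| = i of the number of codewords vanishing on [A]. That number is
    [card_code_vanishing]; its mean is expressed by weights in [mean_card_code_vanishing]. The two
    tails of [W_n^+] and the geometric sum due to the zero codeword combine into the tail of Z(T, q)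
    ([norm_rank_gen_plus_at_card]), which starts at T^(m + 1) and so does not affect the
    congruences. What remains is the polynomial with coefficients gam_(d + j). It is tied to [a] by
    one homogeneous congruence, [dvdp_homog_binom_transform], whose cases z = 1 and y = 1 give the
    two stated ones. Equality with [zeta1] then follows from the degree bound [size_zeta_numerator]
    and the uniqueness of the zeta polynomial. *)

Definition negbin_sum (R : pzSemiRingType) (x z : R) (r L : nat) : R :=
  \sum_(l < L.+1) (x ^+ l * z ^+ (L - l)) *+ 'C(r + l, l).

Lemma negbin_sumS (R : pzSemiRingType) (x z : R) r L : GRing.comm x z ->
  negbin_sum x z r L.+1 =
  z * negbin_sum x z r L + x ^+ L.+1 *+ 'C(r + L.+1, L.+1).
Proof.
move=> cxz; rewrite /negbin_sum big_ord_recr /= subnn expr0 mulr1.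
congr (_ + _).
rewrite mulr_sumr; apply: eq_bigr => l _.
rewrite subSn; last by rewrite -ltnS.
rewrite exprS mulrnAr !mulrA.
by rewrite (commrX _ (commr_sym cxz)).
Qed.

Lemma negbin_sum_recl (R : comPzRingType) (x y : R) r L :
  y * negbin_sum x (x + y) r.+1 L =
  (x + y) * negbin_sum x (x + y) r L - x ^+ L.+1 *+ 'C(r + L.+1, L).
Proof.
elim: L => [|L IH].
  by rewrite /negbin_sum !big_ord1 !bin0 !expr0; ring.
rewrite !negbin_sumS; try exact: mulrC.
rewrite mulrDr mulrCA IH addSnnS !addnS !binS.
rewrite !mulrnDr !exprS; ring.
Qed.

Lemma negbin_expansion (R : comPzRingType) (x y : R) r L :
  exists e, (x + y) ^+ (r.+1 + L) =
            y ^+ r.+1 * negbin_sum x (x + y) r L + x ^+ L.+1 * e.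
Proof.
elim: r => [|r [e IH]].
  exists 1; elim: L => [|L IH].
    by rewrite /negbin_sum big_ord1 /= bin0; ring.
  rewrite negbin_sumS; last exact: mulrC.
  by rewrite addnS exprS IH add0n binn !exprS expr0; ring.
exists (y ^+ r.+1 *+ 'C(r + L.+1, L) + (x + y) * e).
rewrite addSn exprS IH (exprSr y r.+1) -[_ * y * _]mulrA negbin_sum_recl.
by rewrite -[x ^+ _ *+ _]mulr_natr -[y ^+ _ *+ _]mulr_natr; ring.
Qed.

(** If p has degree at most m, this is y^m p(X / y): a polynomial stand-in for the substitution of a
    fraction. *)
Definition homog (R : comNzRingType) (m : nat) (p y : {poly R}) : {poly R} :=
  \sum_(i < m.+1) p`_i *: ('X^i * y ^+ (m - i)).

(** If a has degree at most m, this is the coefficient of X^l in X^d (1 - X)^-(d + 1) a(X / (1 -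
    X)). *)
Definition binom_transform (R : comNzRingType) (d m : nat) (a : {poly R})
    (l : nat) : R :=
  \sum_(i < m.+1) a`_i * 'C(l, d + i)%:R.

Definition binom_transform_poly (R : comNzRingType) (d m : nat)
    (a : {poly R}) : {poly R} :=
  \poly_(j < m.+1) binom_transform d m a (d + j).

(** After exchanging the sums, binomial(d + j, d + i) vanishes for j < i, and the shift j = i + l
    turns the other terms into a negative binomial sum. *)
Lemma homog_binom_transform (R : comNzRingType) (d m : nat) (a z : {poly R}) :
  homog m (binom_transform_poly d m a) z =
  \sum_(i < m.+1) a`_i *: ('X^i * negbin_sum 'X z (d + i) (m - i)).
Proof.
rewrite /homog.
under eq_bigr => j _ do
  rewrite coef_poly ltn_ord /binom_transform scaler_suml.
rewrite exchange_big /=; apply: eq_bigr => i _.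
under eq_bigr => j _ do rewrite -scalerA.
rewrite -scaler_sumr; congr (_ *: _).
have im : (i <= m)%N by rewrite -ltnS.
rewrite -(big_mkord xpredT
  (fun j => 'C(d + j, d + i)%:R *: ('X^j * z ^+ (m - j)))).
rewrite (@big_cat_nat _ _ _ i) //=; last exact: leqW.
rewrite big_nat_cond big1 ?add0r; last first.
  by move=> j /andP[/andP[_ ji] _]; rewrite bin_small ?ltn_add2l // scale0r.
rewrite -{1}[nat_of_ord i]add0n big_addn big_mkord subSn //.
rewrite /negbin_sum mulr_sumr; apply: eq_bigr => l _.
rewrite mulrnAr mulrA -exprD scaler_nat [(l + i)%N]addnC subnDA addnA.
by rewrite -(bin_sub (leq_addr l (d + i))) addKn.
Qed.

(** With S the transform of a of degree at most m, this is (z / y)^(d + 1) a(X / y) = S(X / z)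
    modulo X^(m + 1), cleared of denominators. It holds term by term in a, by [negbin_expansion]
    with r = d + i. The choice z = 1, y = 1 - X serves the congruence in T, and y = 1, z = 1 + X the
    one in t. *)
Lemma dvdp_homog_binom_transform (R : fieldType) (d m : nat)
    (a y z : {poly R}) : z = 'X + y ->
  'X^(m.+1) %| z ^+ (d.+1 + m) * homog m a y -
               y ^+ (d.+1 + m) * homog m (binom_transform_poly d m a) z.
Proof.
move=> zE; rewrite homog_binom_transform /homog !mulr_sumr -sumrB.
apply: (big_ind (dvdp 'X^(m.+1))) => [|p1 p2|i _]; first exact: dvdp0.
  exact: dvdp_add.
have im : (i <= m)%N by rewrite -ltnS.
have [e] := negbin_expansion 'X y (d + i) (m - i); rewrite -zE => zX.
apply/dvdpP; exists (a`_i *: (y ^+ (m - i) * e)).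
have -> : 'X^(m.+1) = 'X^i * 'X^((m - i).+1) :> {poly R}.
  by rewrite -exprD; congr (_ ^+ _); lia.
have yX : y ^+ (d.+1 + m) = y ^+ (m - i) * y ^+ (d + i).+1.
  by rewrite -exprD; congr (_ ^+ _); lia.
have -> : (d.+1 + m = (d + i).+1 + (m - i))%N by lia.
rewrite zX.
have -> : ((d + i).+1 + (m - i) = d.+1 + m)%N by lia.
by rewrite yX -!mul_polyC; ring.
Qed.

Lemma homog1 (R : comNzRingType) m (p : {poly R}) :
  (size p <= m.+1)%N -> homog m p 1 = p.
Proof.
move=> sp; rewrite /homog; under eq_bigr => i _ do rewrite expr1n mulr1.
rewrite -(poly_def m.+1 (fun i => p`_i)).
apply/polyP => i; rewrite coef_poly; case: ltnP => //.
by move=> /(leq_trans sp) /leq_sizeP->.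
Qed.

Lemma horner_homog m (p y : {poly rat}) : (size p <= m.+1)%N -> y != 0 ->
  (map_poly ratfun1_const p).[('X%:F / y%:F)] = (homog m p y)%:F / (y ^+ m)%:F.
Proof.
move=> sp y0; rewrite (@horner_coef_wide _ m.+1); last first.
  by rewrite (leq_trans (size_poly _ _)).
rewrite rmorph_sum /= mulr_suml; apply: eq_bigr => i _.
have im : (i <= m)%N by rewrite -ltnS.
rewrite coef_map (expr_div_subn _ _ im) ?tofrac_eq0 // -mul_polyC.
by rewrite !rmorphM !rmorphXn /= !mulrA.
Qed.

(** * Codewords vanishing on a set of coordinates *)

Lemma col_mulmx (R : pzSemiRingType) m n p (A : 'M[R]_(m, n))
    (B : 'M[R]_(n, p)) j :
  col j (A *m B) = A *m col j B.
Proof. by rewrite !colE mulmxA. Qed.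

Section Count.
Variables (F : finFieldType) (n k : nat).
Implicit Types (C : {vspace 'rV[F]_n}) (M : 'M[F]_(k, n)).

(** Rank-nullity: the rows sought form the left kernel of the matrix whose columns are a basis of
    [U]. *)
Lemma card_row_annihilator (U : {vspace 'cV[F]_k}) (P : pred 'rV[F]_k) :
  (forall u : 'rV_k, reflect (forall w, w \in U -> u *m w = 0) (P u)) ->
  #|[set u | P u]| = (#|F| ^ (k - \dim U))%N.
Proof.
move=> PP; set X := vbasis U.
pose B : 'M[F]_(k, \dim U) := \matrix_(i, j) (tnth X j) i 0.
have colB j : col j B = tnth X j.
  by apply/colP => i; rewrite !mxE.
have rkB : \rank B = \dim U.
  rewrite -mxrank_tr; apply/eqP/row_freeP/row_freeP.
  rewrite -kermx_eq0; apply/rowV0P => v /sub_kermxP vB.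
  have /freeP fX : free X by exact: basis_free (vbasisP U).
  apply/rowP => j; rewrite mxE; apply: fX => {j}.
  apply/colP => i; rewrite summxE [RHS]mxE.
  have /rowP/(_ i) := vB; rewrite !mxE => vBi; rewrite -[RHS]vBi.
  by apply: eq_bigr => j _; rewrite !mxE (tnth_nth 0).
transitivity #|rowg (kermx B)|; last by rewrite card_rowg mxrank_ker rkB.
apply: eq_card => u; rewrite !inE; apply/PP/sub_kermxP => [uU|uB w wU].
  apply/rowP => j; transitivity (col j (u *m B) 0 0); first by rewrite !mxE.
  by rewrite col_mulmx colB uU ?vbasis_mem ?mem_tnth // !mxE.
rewrite (coord_vbasis wU) mulmx_sumr big1 // => j _.
by rewrite -scalemxAr -tnth_nth -colB -col_mulmx uB col0 scaler0.
Qed.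

Lemma generator_row_free C M : is_generator_matrix C M -> row_free M.
Proof.
move=> gM; rewrite -kermx_eq0; apply/rowV0P => v /sub_kermxP vM.
have /freeP fX : free [tuple row i M | i < k].
  exact: basis_free gM.
apply/rowP => i; rewrite mxE.
apply: (fX (fun i => v 0 i)) => {i}.
rewrite -[RHS]vM mulmx_sum_row; apply: eq_bigr => i _.
by rewrite -tnth_nth tnth_mktuple.
Qed.

Lemma mem_codeP C M : is_generator_matrix C M ->
  forall v, reflect (exists u, v = u *m M) (v \in C).
Proof.
move=> gM v; have /andP[/eqP spM _] := gM.
apply: (iffP idP) => [|[u ->]].
  rewrite -{1}spM.
  have -> : [seq row i M | i : 'I_k] = [tuple row i M | i < k] by [].
  move/coord_span->; exists (\row_i coord [tuple row i M | i < k] i v).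
  rewrite mulmx_sum_row; apply: eq_bigr => i _.
  by rewrite mxE -tnth_nth tnth_mktuple.
rewrite mulmx_sum_row memv_suml // => i _; rewrite memvZ //.
rewrite -spM memv_span //; apply/codomP; by exists i.
Qed.

(** Encoding u |-> u M is a bijection from F^k onto C, and u M vanishes on [A] exactly when u
    annihilates the span of the columns in [A]. *)
Lemma card_code_vanishing C M (A : {set 'I_n}) : is_generator_matrix C M ->
  #|[set v | (v \in C) && [forall j in A, v 0 j == 0]]| =
  (#|F| ^ (k - col_rank M A))%N.
Proof.
move=> gM.
rewrite -(card_row_annihilator (P := fun u : 'rV_k =>
                                  [forall j in A, (u *m M) 0 j == 0])).
  have injM : injective (mulmxr M : 'rV_k -> 'rV_n).
    have /row_freeP[M' MM'] := generator_row_free gM.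
    move=> u1 u2 /(congr1 (mulmxr M')) /=.
    by rewrite -!mulmxA MM' !mulmx1.
  rewrite -(card_imset _ injM); apply: eq_card => v; rewrite inE.
  apply/andP/imsetP => [[/(mem_codeP gM)[u ->] uA]|[u]].
    by exists u; rewrite ?inE.
  rewrite inE => uA ->; split=> //.
  by apply/(mem_codeP gM); exists u.
have uME u j : (u *m M) 0 j = (u *m col j M) 0 0 by rewrite -col_mulmx [RHS]mxE.
move=> u; apply: (iffP forall_inP) => [uA w wU|uU j jA]; last first.
  by rewrite uME uU ?mxE // memv_span //; apply/imageP; exists j.
move: wU; have -> : [seq col j M | j in A] = 
   in_tuple [seq col j M | j in A] by [].
move=> /coord_span->; rewrite mulmx_sumr big1 // => i _.
rewrite -scalemxAr.
have /imageP[j jA ->] := mem_nth 0 (ltn_ord i).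
apply/matrixP => a b; rewrite !ord1 [LHS]mxE -uME (eqP (uA _ jA)) mulr0.
by rewrite mxE.
Qed.

Lemma col_rank_le_card M (A : {set 'I_n}) : (col_rank M A <= #|A|)%N.
Proof. by rewrite (leq_trans (dim_span _)) // size_map -cardE. Qed.

(** Only the zero codeword vanishes at all coordinates, so q^(k - r(G)) = 1. *)
Lemma col_rank_setT C M : is_generator_matrix C M -> col_rank M setT = k.
Proof.
move=> gM; apply/eqP; rewrite eqn_leq.
have -> : (col_rank M setT <= k)%N.
  by rewrite (leq_trans (dimvS (subvf _))) // dimvf /dim /= muln1.
have := card_code_vanishing setT gM.
rewrite (_ : [set v | _] = [set 0]) ?cards1 => [q1|].
  rewrite -subn_eq0; case: posnP => // r0; move: q1.
  rewrite -{1}(exp1n (k - col_rank M setT)) => /eqP.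
  by rewrite eqn_exp2r // ltn_eqF // finNzRing_gt1.
apply/setP => v; rewrite !inE; apply/andP/eqP => [[_ /forall_inP v0]|->].
  by apply/rowP => j; rewrite mxE (eqP (v0 j _)) // inE.
by rewrite mem0v; split=> //; apply/forall_inP => j _; rewrite mxE.
Qed.

Lemma col_rank_le M (A : {set 'I_n}) : (col_rank M A <= k)%N.
Proof. by rewrite (leq_trans (dimvS (subvf _))) // dimvf /dim /= muln1. Qed.

Lemma sum_card_code_vanishing C M (i : nat) : is_generator_matrix C M ->
  (\sum_(A : {set 'I_n} | #|A| == i) #|F| ^ (k - col_rank M A) =
   \sum_(v in C) 'C(n - wt v, i))%N.
Proof.
move=> gM.
rewrite (eq_bigr (fun A : {set 'I_n} =>
    \sum_(v in C) if [forall j in A, (v 0 j == 0)%R] then 1 else 0)%N);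
  last first.
  by move=> A _; rewrite -(card_code_vanishing A gM) -sum1dep_card big_mkcondr.
rewrite exchange_big /=; apply: eq_bigr => v vC.
rewrite -big_mkcondr sum1dep_card.
have -> : (n - wt v)%N = #|~: [set j | v 0 j != 0]|.
  by rewrite cardsCs setCK card_ord.
rewrite -cards_draws; apply: eq_card => A; rewrite !inE andbC; congr andb.
apply/forall_inP/subsetP => [vA j /vA|vA j /vA]; by rewrite !inE negbK.
Qed.

Lemma wt_eq0 (v : 'rV[F]_n) : (wt v == 0)%N = (v == 0).
Proof.
rewrite /wt cards_eq0; apply/eqP/eqP => [v0|->].
  by apply/rowP => j; move/setP: v0 => /(_ j); rewrite !inE mxE => /negbFE/eqP.
by apply/setP => j; rewrite !inE mxE eqxx.
Qed.

Lemma min_distance_le_wt C v : v \in C -> v != 0 -> (min_distance C <= wt v)%N.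
Proof.
move=> vC v0; rewrite /min_distance -big_filter.
have: v \in [seq w <- index_enum _ | (w \in C) && (w != 0)].
  by rewrite mem_filter vC v0 mem_index_enum.
elim: [seq _ <- _ | _] => // w s IH; rewrite big_cons geq_min inE.
by case/predU1P => [->|/IH->]; rewrite ?leqnn ?orbT.
Qed.

Lemma min_distance_le_length C : (min_distance C <= n)%N.
Proof.
rewrite /min_distance; apply: (big_ind (fun m => m <= n)%N) => //.
  by move=> a b an bn; rewrite geq_min an.
by move=> v _; rewrite (leq_trans (max_card _)) // card_ord.
Qed.

Lemma wt_le_length (v : 'rV[F]_n) : (wt v <= n)%N.
Proof. by rewrite (leq_trans (max_card _)) // card_ord. Qed.

Lemma min_distance_gt0 C : C != 0%VS -> (0 < min_distance C)%N.
Proof.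
move=> C0; rewrite /min_distance; apply: (big_ind (fun m => 0 < m)%N).
(* The default value [n] of the minimum must be positive too: for n = 0 the only vector is 0. *)
- rewrite lt0n; apply: contraNneq C0 => n0.
  rewrite -subv0; apply/subvP => v _; rewrite memv0 -wt_eq0.
  by rewrite -leqn0 (leq_trans (wt_le_length v)) ?n0.
- by move=> a b a0 b0; rewrite leq_min a0.
by move=> v /andP[_]; rewrite -wt_eq0 lt0n.
Qed.

Lemma sum_code_by_weight C (f : nat -> nat) : C != 0%VS ->
  (\sum_(v in C) f (wt v) =
   f 0 + \sum_(i < (n - min_distance C).+1)
     wt_count C (min_distance C + i) * f (min_distance C + i))%N.
Proof.
move=> C0; rewrite (bigD1 0) ?mem0v //=.
have /eqP -> : wt (0 : 'rV[F]_n) == 0%N by rewrite wt_eq0.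
congr addn.
set d := min_distance C.
have dn : (d <= n)%N := min_distance_le_length C.
have wP (v : 'rV_n) : (v \in C) && (v != 0) -> (wt v - d < (n - d).+1)%N.
  by rewrite ltnS leq_sub2r ?wt_le_length.
rewrite (partition_big
  (fun v : 'rV[F]_n => inord (wt v - d) : 'I_(n - d).+1) xpredT) //=.
apply: eq_bigr => i _.
rewrite /wt_count -sum_nat_const.
(* Positivity of d keeps the zero word, already split off, out of every class of weight d + i. *)
have d0 := min_distance_gt0 C0.
apply: eq_big => v.
  rewrite inE -andbA; case vC: (v \in C) => //=.
  case: eqVneq => [->|v0] /=.
    apply/esym/negbTE; rewrite (eqP (_ : wt 0 == 0)%N) ?wt_eq0 //.
    by rewrite ltn_eqF // addn_gt0 d0.
  have dw := min_distance_le_wt vC v0.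
  rewrite -val_eqE /= inordK ?wP ?vC //.
  by rewrite -(eqn_add2l d) subnKC.
move=> /andP[/andP[vC v0] /eqP <-].
by rewrite inordK ?wP ?vC // subnKC // min_distance_le_wt.
Qed.

End Count.

(** * Specialisation of the two-variable zeta function at u = c *)

(** Both sides count the pairs of disjoint subsets of sizes w and i in a set of n elements. *)
Lemma bin_swap n w i : (w <= n)%N -> (i <= n)%N ->
  ('C(n, w) * 'C(n - w, i) = 'C(n, i) * 'C(n - i, w))%N.
Proof.
move=> wn le_in; have [wi|wi] := leqP (w + i) n; last first.
  by rewrite !(@bin_small (_ - _)) ?muln0 //; lia.
have h1 := bin_fact wn; have h2 := bin_fact le_in.
have h3 : (i <= n - w)%N by lia.
have h4 : (w <= n - i)%N by lia.
move/bin_fact: h3 => h3; move/bin_fact: h4 => h4.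
apply/eqP; rewrite -(eqn_pmul2r (fact_gt0 w)) -(eqn_pmul2r (fact_gt0 i)).
rewrite -(eqn_pmul2r (fact_gt0 (n - w - i))).
rewrite (_ : n - i - w = n - w - i)%N in h4; last by lia.
by apply/eqP; move: h1 h2; rewrite -h3 -h4; lia.
Qed.

Lemma card_subr1_neq0 (F : finFieldType) : #|F|%:R - 1 != 0 :> rat.
Proof.
by rewrite subr_eq0 -[1]/(1%:R) eqr_nat gtn_eqF // finNzRing_gt1.
Qed.

Lemma addf_div3 (K : fieldType) (a x y d1 d2 e : K) :
  d1 != 0 -> d2 != 0 -> e != 0 ->
  (a + x / d1 + y / d2) / e = (a * (d1 * d2) + x * d2 + y * d1) / (d1 * d2 * e).
Proof. by move=> d10 d20 e0; field; rewrite d10 d20 e0. Qed.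

(** Over the common denominator [D1 * D2 * D3], which does not vanish at u = c, the value is
    computed by [ratfun_evalE]. *)
Lemma ratfun_eval_norm_rank_gen_plus (F : finFieldType) n k
    (M : 'M[F]_(k, n)) (K : fieldType) (T c : K) (z : int) :
  T != 0 -> 1 - T^-1 != 0 -> c != 1 -> 1 - c * T != 0 ->
  ratfun_eval (idfun : {rmorphism K -> K})
    (norm_rank_gen_plus M ('X%:F * T%:P%:F) T%:P%:F^-1 /
      (('X%:F - 1) * T%:P%:F ^ z)) c =
  norm_rank_gen_plus M (c * T) T^-1 / ((c - 1) * T ^ z).
Proof.
move=> T0 T1 c1 cT.
pose j : {rmorphism K -> {fraction {poly K}}} := (@tofrac {poly K} \o @polyC K).
pose N : {poly K} := \sum_(i < n.+1) ('C(n, i)%:R^-1)%:P *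
    \sum_(A : {set 'I_n} | #|A| == i)
      ('X * T%:P) ^+ (col_rank M [set: 'I_n] - col_rank M A) *
      (T^-1)%:P ^+ (#|A| - col_rank M A).
have TV : T%:P%:F^-1 = (T^-1)%:P%:F by rewrite -[RHS]/(j _) fmorphV.
have TVz : T%:P%:F ^ z = (T ^ z)%:P%:F by rewrite -[RHS]/(j _) fmorphXz.
have NF : norm_rank_gen M ('X%:F * T%:P%:F) T%:P%:F^-1 = N%:F.
  rewrite /N rmorph_sum; apply: eq_bigr => i _; rewrite rmorphM; congr (_ * _).
    by rewrite -[RHS]/(j _) fmorphV rmorph_nat.
  rewrite rmorph_sum; apply: eq_bigr => A _.
  by rewrite rmorphM !rmorphXn rmorphM TV.
have Nc : N.[c] = norm_rank_gen M (c * T) T^-1.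
  rewrite horner_sum; apply: eq_bigr => i _.
  rewrite hornerM hornerC; congr (_ * _).
  rewrite horner_sum; apply: eq_bigr => A _.
  by rewrite hornerM !horner_exp hornerM hornerX !hornerC.
set D1 := 1 - 'X * T%:P : {poly K}.
set D2 := (1 - T^-1)%:P : {poly K}.
set D3 := ('X - 1) * (T ^ z)%:P : {poly K}.
pose A := N * (D1 * D2) + ('X * T%:P) ^+ k.+1 * D2 +
          (T^-1)%:P ^+ (n - k).+1 * D1.
have D1c : D1.[c] = 1 - c * T by rewrite !hornerE.
have D2c : D2.[c] = 1 - T^-1 by rewrite !hornerE.
have D3c : D3.[c] = (c - 1) * T ^ z by rewrite !hornerE.
have nz (p : {poly K}) : p.[c] != 0 -> p%:F != 0.
  by rewrite tofrac_eq0; apply: contraNneq => ->; rewrite horner0.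
have D30 : (c - 1) * T ^ z != 0 by rewrite mulf_neq0 ?subr_eq0 // expfz_neq0.
have -> : norm_rank_gen_plus M ('X%:F * T%:P%:F) T%:P%:F^-1 /
      (('X%:F - 1) * T%:P%:F ^ z) = A%:F / (D1 * D2 * D3)%:F.
  rewrite /norm_rank_gen_plus NF TV TVz.
  have -> : ('X%:F - 1) * (T ^ z)%:P%:F = D3%:F.
    by rewrite rmorphM rmorphB rmorph1.
  have -> : 1 - 'X%:F * T%:P%:F = D1%:F by rewrite rmorphB rmorphM rmorph1.
  have -> : 1 - (T^-1)%:P%:F = D2%:F by rewrite -[RHS]/(j _) rmorphB rmorph1.
  have := nz D1; have := nz D2; have := nz D3; rewrite D1c D2c D3c.
  move=> /(_ D30) d3 /(_ T1) d2 /(_ cT) d1.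
  clearbody D1 D2 D3 N.
  apply: etrans (addf_div3 _ _ _ d1 d2 d3) _.
  by rewrite /A !rmorphD !rmorphM !rmorphXn rmorphM.
clearbody D1 D2 D3 N.
rewrite ratfun_evalE !map_poly_id //; last first.
  by rewrite !hornerM D1c D2c D3c (mulf_neq0 (mulf_neq0 cT T1) D30).
rewrite !hornerM /A !hornerD !hornerM !horner_exp hornerM hornerX !hornerC.
by rewrite Nc D1c D2c D3c /norm_rank_gen_plus addf_div3.
Qed.

Section RatfunSum.
Variables (F : finFieldType) (n k : nat) (C : {vspace 'rV[F]_n}).
Variable M : 'M[F]_(k, n).
Hypotheses (C0 : C != 0%VS) (gM : is_generator_matrix C M).

Let q : rat := #|F|%:R.
Let d := min_distance C.
Let m := (n - d)%N.
Let gam := binom_transform d m (norm_wt_enum C).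

(** The zero codeword contributes 1. A word of weight w vanishes on binomial(n - w, i) sets of size
    i, and [bin_swap] gives binomial(n - w, i) / binomial(n, i) = binomial(n - i, w) / binomial(n,
    w). *)
Lemma mean_card_code_vanishing i : (i <= n)%N ->
  ('C(n, i)%:R)^-1 *
    \sum_(A : {set 'I_n} | #|A| == i) q ^+ (k - col_rank M A) =
  1 + (q - 1) * gam (n - i).
Proof.
move=> le_in.
have bnz j : (j <= n)%N -> 'C(n, j)%:R != 0 :> rat.
  by move=> jn; rewrite pnatr_eq0 -lt0n bin_gt0.
have q1 : q - 1 != 0 := card_subr1_neq0 F.
under eq_bigr => A _ do rewrite /q -natrX.
rewrite -natr_sum (sum_card_code_vanishing i gM).
rewrite (sum_code_by_weight (fun w => 'C(n - w, i)) C0).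
rewrite subn0 natrD mulrDr mulVf ?bnz //.
congr (1 + _); rewrite natr_sum /gam /binom_transform !mulr_sumr -/d -/m.
apply: eq_bigr => l _.
have lm : (l <= m)%N by rewrite -ltnS.
have dn : (d <= n)%N := min_distance_le_length C.
have wn : (d + l <= n)%N by rewrite -leq_subRL.
rewrite /norm_wt_enum coefZ coef_poly -/d -/m ltn_ord -/q.
rewrite mulrA mulrA mulrA divff // mul1r natrM.
apply: (mulfI (bnz _ le_in)); rewrite mulrA divff ?bnz // mul1r.
apply: (mulfI (bnz _ wn)).
rewrite mulrCA -natrM bin_swap // natrM.
by field; rewrite bnz.
Qed.
End RatfunSum.

(** * The rational function Z(T, q) *)

(** Here a, b, c, x stand for T^k, T^d, T^m, q^k, and s for the value of the polynomial part at
    T. *)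
Lemma zeta_field_identity (K : fieldType) (T Q a b c s x : K) :
  T != 0 -> 1 - T != 0 -> 1 - Q * T != 0 -> Q - 1 != 0 ->
  a != 0 -> b != 0 -> c != 0 ->
  (a * ((1 - T * (b * c)) / (1 - T) + (Q - 1) * (b * s)) / (b * c) +
   Q * x * (T * a) / (1 - Q * T) +
   T^-1 * (a / (b * c)) / (1 - T^-1)) / ((Q - 1) * (a * b / (b * c))) =
  (s * (1 - T) * (1 - Q * T) +
   T * c * ((Q * x - 1) / (Q - 1) - Q * ((x - 1) / (Q - 1)) * T)) /
  ((1 - T) * (1 - Q * T)).
Proof.
move=> T0 T1 QT Q1 a0 b0 c0.
have T1' : T - 1 != 0 by rewrite -opprB oppr_eq0.
have -> : 1 - T^-1 = (T - 1) / T by field.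
by field; rewrite T0 T1 T1' QT Q1 a0 b0 c0.
Qed.

Lemma subr1_inv_neq0 (K : fieldType) (x : K) : 1 - x != 0 -> 1 - x^-1 != 0.
Proof. by rewrite !subr_eq0 eq_sym [1 == _]eq_sym invr_eq1. Qed.

Lemma horner_ratfun1X (p : {poly rat}) :
  (map_poly ratfun1_const p).['X%:F] = p%:F.
Proof.
rewrite -[in RHS](coefK p) poly_def rmorph_sum.
rewrite (horner_coef_wide _ (size_poly _ _)); apply: eq_bigr => i _.
by rewrite coef_map -mul_polyC rmorphM rmorphXn.
Qed.

Lemma tofrac_numerator (s a b : {poly rat}) j (c1 c2 : rat) :
  (s * (a * b) + 'X^j * (c1%:P - c2%:P * 'X))%:F =
  s%:F * a%:F * b%:F +
  'X%:F ^+ j * (ratfun1_const c1 - ratfun1_const c2 * 'X%:F).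
Proof.
rewrite rmorphD; congr (_ + _); first by rewrite !rmorphM mulrA.
by rewrite rmorphM rmorphXn rmorphB [X in _ - X]rmorphM.
Qed.

Section ZetaAtCard.
Variables (F : finFieldType) (n k : nat) (C : {vspace 'rV[F]_n}).
Variable M : 'M[F]_(k, n).
Hypotheses (C0 : C != 0%VS) (gM : is_generator_matrix C M).

Let q : rat := #|F|%:R.
Let d := min_distance C.
Let m := (n - d)%N.
Let S := binom_transform_poly d m (norm_wt_enum C).
Let gam := binom_transform d m (norm_wt_enum C).

Lemma norm_rank_gen_at_card (K : fieldType) (J : {rmorphism rat -> K}) (T : K) :
  T != 0 ->
  norm_rank_gen M (J q * T) T^-1 =
  T ^+ k * (\sum_(i < n.+1) T ^+ i +
            (J q - 1) * (T ^+ d * (map_poly J S).[T])) / T ^+ n.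
Proof.
move=> T0; apply: (canRL (mulfK (expf_neq0 n T0))).
have -> : \sum_(i < n.+1) T ^+ i + (J q - 1) * (T ^+ d * (map_poly J S).[T]) =
    \sum_(i < n.+1) J (1 + (q - 1) * gam i) * T ^+ i.
  under [RHS]eq_bigr => i _ do
    rewrite rmorphD rmorphM rmorphB rmorph1 mulrDl mul1r -mulrA.
  rewrite big_split -mulr_sumr /=; congr (_ + _ * _).
  have dn : (d <= n)%N := min_distance_le_length C.
  rewrite -(big_mkord xpredT (fun i => J (gam i) * T ^+ i)).
  (* The coefficients gam_i with i < d are 0, which accounts for the factor T^d. *)
  rewrite (@big_cat_nat _ _ _ d) //=; last exact: leqW.
  rewrite big_nat_cond big1 ?add0r; last first.
    move=> i /andP[/andP[_ id] _].
    rewrite /gam /binom_transform big1 ?rmorph0 ?mul0r //.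
    by move=> l _; rewrite bin_small ?mulr0 // ltn_addr.
  have -> : \sum_(d <= i < n.+1) J (gam i) * T ^+ i =
      \sum_(i < m.+1) J (gam (i + d)%N) * T ^+ (i + d).
    rewrite -[X in \big[_/_]_(X <= _ < _) _]add0n big_addn subSn //.
    exact: big_mkord.
  rewrite (@horner_coef_wide _ m.+1); last first.
    by rewrite (leq_trans (size_poly _ _)) // size_poly.
  rewrite mulr_sumr; apply: eq_bigr => i _.
  rewrite coef_map /S coef_poly ltn_ord [(i + d)%N]addnC exprD.
  by rewrite /= mulrCA.
(* Sets of size i contribute T^(k - i), which is T^k T^(n - i) after multiplication by T^n; hence
   the reversal. *)
rewrite (reindex_inj rev_ord_inj) /= mulr_sumr /norm_rank_gen mulr_suml.
apply: eq_bigr => i _; have le_in : (i <= n)%N by rewrite -ltnS.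
rewrite subSS -(mean_card_code_vanishing C0 gM le_in) rmorphM fmorphV.
rewrite -mulrA mulrCA -!mulrA; congr (_ * _); first by rewrite rmorph_nat.
rewrite mulr_suml rmorph_sum mulr_suml mulr_sumr.
apply: eq_bigr => A /eqP sA; rewrite rmorphXn.
have := col_rank_le_card M A; have := col_rank_le M A.
rewrite (col_rank_setT gM) sA => rk ri.
rewrite exprMn -!mulrA [RHS]mulrCA; congr (_ * _).
rewrite exprVn mulrCA; apply: (canLR (mulKf (expf_neq0 _ T0))).
rewrite -!exprD; congr (_ ^+ _).
lia.
Qed.

(* The second summand sums the tail of Z(T, q): for j > m, the coefficient    *)
(* of T^j is (q^(k + j - m) - 1) / (q - 1).                                   *)
Definition zeta_numerator : {poly rat} :=
  S * ((1 - 'X) * (1 - #|F|%:R * 'X)) +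
  'X^(m.+1) * (((q ^+ k.+1 - 1) / (q - 1))%:P -
               (q * ((q ^+ k - 1) / (q - 1)))%:P * 'X).

(** The sum T^(k - n) (1 + ... + T^n) and the tail in y add up to -T^(k + 1) / (1 - T). Together
    with the tail in x, divided by (q - 1) T^(1 - g), this is T^(m + 1) / (q - 1) times q^(k + 1) /
    (1 - q T) - 1 / (1 - T). *)
Lemma norm_rank_gen_plus_at_card (K : fieldType) (J : {rmorphism rat -> K})
    (T : K) :
  T != 0 -> 1 - T != 0 -> 1 - J q * T != 0 ->
  norm_rank_gen_plus M (J q * T) T^-1 /
    ((J q - 1) * T ^ (1 - (n%:Z + 1 - k%:Z - d%:Z))) =
  ((map_poly J S).[T] * (1 - T) * (1 - J q * T) +
   T ^+ m.+1 * (J ((q ^+ k.+1 - 1) / (q - 1)) -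
                J (q * ((q ^+ k - 1) / (q - 1))) * T)) /
  ((1 - T) * (1 - J q * T)).
Proof.
move=> T0 T1 QT.
have Q1 : J q - 1 != 0.
  rewrite -(rmorph1 J) -rmorphB fmorph_eq0.
  exact: card_subr1_neq0.
have dn : (d <= n)%N := min_distance_le_length C.
have kn : (k <= n)%N.
  have := generator_row_free gM; rewrite /row_free => /eqP <-.
  exact: rank_leq_col.
have TX j : T ^+ j != 0 by rewrite expf_neq0.
have Tn : T ^+ n = T ^+ d * T ^+ m by rewrite -exprD subnKC.
have -> : T ^ (1 - (n%:Z + 1 - k%:Z - d%:Z)) =
    T ^+ k * T ^+ d / (T ^+ d * T ^+ m).
  rewrite -Tn (_ : 1 - _ = (k + d)%N%:Z + - n%:Z); last by lia.
  by rewrite expfzDr // -exprnP -exprnN exprD.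
have Tr : T^-1 ^+ (n - k).+1 = T^-1 * (T ^+ k / (T ^+ d * T ^+ m)).
  rewrite exprS -Tn exprVn; congr (_ * _).
  by rewrite -{2}(subnKC kn) exprD invfM mulVKf.
have sT : \sum_(i < n.+1) T ^+ i = (1 - T * (T ^+ d * T ^+ m)) / (1 - T).
  apply: (canRL (mulfK T1)); rewrite -Tn -exprS -[LHS]opprK -mulrN opprB.
  by rewrite mulrC -subrX1 opprB.
have Jq j : J ((q ^+ j - 1) / (q - 1)) = (J q ^+ j - 1) / (J q - 1).
  by rewrite fmorph_div !rmorphB rmorphXn !rmorph1.
rewrite [J (q * _)]rmorphM !Jq /norm_rank_gen_plus norm_rank_gen_at_card //.
by rewrite Tr sT Tn exprMn !exprS zeta_field_identity.
Qed.

Lemma zeta2_at_card :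
  ratfun_at_u (zeta2 C M) q =
  zeta_numerator%:F / ((1 - 'X) * (1 - #|F|%:R * 'X))%:F.
Proof.
have nz (p : {poly rat}) : p`_0 != 0 -> p%:F != 0.
  by rewrite tofrac_eq0; apply: contraNneq => ->; rewrite coef0.
pose T : ratfun1 := 'X%:F.
have T0 : T != 0 by rewrite tofrac_eq0 polyX_eq0.
have T1E : 1 - T = (1 - 'X)%:F by rewrite rmorphB rmorph1.
have T1 : 1 - T != 0.
  by rewrite T1E nz // coefB coef1 coefX subr0 oner_neq0.
have QTE : 1 - ratfun1_const q * T = (1 - #|F|%:R * 'X)%:F.
  by rewrite rmorphB rmorph1 rmorphM /= polyC_natr.
have QT : 1 - ratfun1_const q * T != 0.
  by rewrite QTE nz // coefB coef1 coefMX subr0 oner_neq0.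
have TV : 1 - T^-1 != 0.
  exact (subr1_inv_neq0 T1).
have Q1 : ratfun1_const q != 1.
  rewrite -(rmorph1 ratfun1_const) (inj_eq (fmorph_inj _)) -subr_eq0.
  exact: card_subr1_neq0.
have E1 := ratfun_eval_norm_rank_gen_plus M (1 - (n%:Z + 1 - k%:Z - d%:Z))
  T0 TV Q1 QT.
apply: etrans E1 _.
rewrite (norm_rank_gen_plus_at_card T0 T1 QT).
rewrite horner_ratfun1X T1E QTE /zeta_numerator tofrac_numerator.
by rewrite [(_ * _)%:F]rmorphM.
Qed.
End ZetaAtCard.

(** * Comparison with the weight enumerator *)

(** With y = 1 + t, the denominator (1 - T) (1 - q T) becomes w / y^2 at T = t / y. The identity
    clears the powers of y in Z(t / y, q), where z stands for y^m and x for t^m. *)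
Lemma subst_field_identity (K : fieldType) (s w y t Q c1 c2 x z b : K) :
  y = 1 + t -> w = y - Q * t -> w != 0 -> y != 0 -> z != 0 ->
  b = (1 - t / y) * (1 - Q * (t / y)) ->
  (s / z * b + x * (t / y) / z * (c1 - c2 * (t / y))) / b =
  (s * w + x * t * (c1 * y - c2 * t)) / (z * w).
Proof.
move=> yE wE w0 y0 z0.
have -> : 1 - t / y = 1 / y by rewrite yE in y0 *; field.
have -> : 1 - Q * (t / y) = w / y by rewrite wE; field.
by move=> ->; field; rewrite y0 w0 z0.
Qed.

Lemma subst_denominator_neq0 (K : fieldType) (w y t Q : K) :
  y = 1 + t -> w = y - Q * t -> w != 0 -> y != 0 ->
  (1 - t / y) * (1 - Q * (t / y)) != 0.
Proof.
move=> yE wE w0 y0.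
have -> : 1 - t / y = 1 / y by rewrite yE in y0 *; field.
have -> : 1 - Q * (t / y) = w / y by rewrite wE; field.
by rewrite !mulf_neq0 ?invr_eq0 ?oner_neq0.
Qed.

Section Final.
Variables (F : finFieldType) (n k : nat) (C : {vspace 'rV[F]_n}).
Variable M : 'M[F]_(k, n).
Hypotheses (C0 : C != 0%VS) (gM : is_generator_matrix C M).

Let q : rat := #|F|%:R.
Let d := min_distance C.
Let m := (n - d)%N.
Let a := norm_wt_enum C.
Let S := binom_transform_poly d m a.
Let gam := binom_transform d m a.

Lemma size_norm_wt_enum : (size a <= m.+1)%N.
Proof. by rewrite (leq_trans (size_scale_leq _ _)) // size_poly. Qed.

Lemma binom_transform_const_rank i r : (i <= n)%N ->
  (forall A : {set 'I_n}, #|A| = i -> col_rank M A = r) ->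
  gam (n - i) = (q ^+ (k - r) - 1) / (q - 1).
Proof.
move=> le_in rA; have := mean_card_code_vanishing C0 gM le_in.
have q1 : q - 1 != 0 := card_subr1_neq0 F.
rewrite (eq_bigr (fun=> q ^+ (k - r))) => [|A /eqP/rA-> //].
rewrite sumr_const -[#|_|]/(#|[pred A : {set 'I_n} | #|A| == i]|).
have -> : #|[pred A : {set 'I_n} | #|A| == i]| = 'C(n, i).
  by rewrite -[n in RHS]card_ord -card_draws; apply: eq_card => A; rewrite !inE.
rewrite -[q ^+ _ *+ _]mulr_natl mulKf => [->|]; last first.
  by rewrite pnatr_eq0 -lt0n bin_gt0.
by rewrite addrC addKr mulrC mulKf.
Qed.

(** The closed form (q^(k + j - m) - 1) / (q - 1) satisfies z_j - (1 + q) z_(j - 1) + q z_(j - 2) =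
    0. As it is already valid at j = m - 1 and j = m, the numerator has no coefficient beyond degree
    m. *)
Lemma size_zeta_numerator : (forall j : 'I_n, col j M != 0) ->
  (0 < k)%N -> (size (zeta_numerator k C) <= m.+1)%N.
Proof.
move=> cM k0.
have q1 : q - 1 != 0 := card_subr1_neq0 F.
have dn : (d <= n)%N := min_distance_le_length C.
have d0 : (0 < d)%N := min_distance_gt0 C0.
have gn : gam n = (q ^+ k - 1) / (q - 1).
  rewrite -{1}[n]subn0 (@binom_transform_const_rank 0 0) ?subn0 // => A /eqP.
  rewrite cards_eq0 => /eqP ->; apply/eqP.
  by rewrite -leqn0 (leq_trans (col_rank_le_card _ _)) // cards0.
have gn1 : gam (n - 1) = (q ^+ (k - 1) - 1) / (q - 1).
  rewrite (@binom_transform_const_rank 1 1) //; first exact: leq_trans d0 dn.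
  move=> A /eqP/cards1P[j ->]; rewrite /col_rank.
  by rewrite /image_mem enum_set1 span_seq1 dim_vline cM.
have Sm : S`_m = gam n by rewrite coef_poly ltnSn /m subnKC.
have Sm1 : (S * 'X)`_m = gam (n - 1).
  (* If m = 0, the coefficient is 0 by convention, and so is gam_(n - 1), because n - 1 < d. *)
  rewrite coefMX; case: eqP => [m0|/eqP m0]; last first.
    rewrite coef_poly ltnS leq_pred; congr gam; rewrite /m in m0 *; lia.
  rewrite /gam /binom_transform big1 // => i _; rewrite bin_small ?mulr0 //.
  rewrite /m in m0; lia.
have Sgt j : (m < j)%N -> S`_j = 0.
  by move=> mj; rewrite coef_poly ltnS leqNgt mj.
have -> : zeta_numerator k C = S - (1 + q) *: (S * 'X) + q *: (S * 'X * 'X) +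
  'X^(m.+1) * (((q ^+ k.+1 - 1) / (q - 1))%:P -
               (q * ((q ^+ k - 1) / (q - 1)))%:P * 'X).
  rewrite /zeta_numerator -/q -/d -/m -/a -/S; congr (_ + _).
  by rewrite -!mul_polyC polyCD -/q !rmorph_nat; ring.
apply/leq_sizeP => j mj; rewrite !coefD coefN !coefZ coefXnM ltnNge mj /=.
rewrite coefB coefC coefCM coefX [(S * 'X * 'X)`_j]coefMX.
(* Only degrees m + 1 and m + 2 involve a cancellation; beyond them every term is 0. *)
rewrite -(subnKC mj); case: (j - m.+1)%N => [|[|l]];
  rewrite ?addn0 ?addn1 ?addnS ?subSS ?subnn ?subSnn /=.
- rewrite Sm1 [(S * 'X)`__]coefMX /= Sgt // Sm gn gn1 subn1.
  rewrite -[in q ^+ k.+1](prednK k0) -[in q ^+ k](prednK k0).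
  by rewrite !exprS; field; rewrite q1.
- by rewrite !coefMX /= (Sgt m.+2) // (Sgt m.+1) // Sm gn; ring.
- have -> : ((m.+1 + l).+1 - m = l.+2)%N by lia.
  by rewrite !coefMX /= !Sgt ?mulr0 ?subr0 ?addr0 //; lia.
Qed.

Let P := zeta_numerator k C.

(** Modulo X^(m + 1) the tail of the numerator disappears; the case z = 1 of the homogeneous
    congruence handles S. *)
Lemma zeta_numerator_congr :
  'X^(m.+1) %| P * (1 - 'X) ^+ (d + m) -
               homog m a (1 - 'X) * (1 - #|F|%:R * 'X).
Proof.
have := dvdp_homog_binom_transform d m a (y := 1 - 'X) (z := 1).
rewrite addrC subrK => /(_ erefl).
rewrite expr1n mul1r homog1 ?size_poly // -/S => dv.
rewrite /P /zeta_numerator -/q -/d -/m -/a -/S.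
set R := (X in _ + 'X^(m.+1) * X).
set w := 1 - #|F|%:R * 'X : {poly rat}.
have -> (x r e h y : {poly rat}) :
    (S * (y * w) + x * r) * e - h * w = x * (r * e) - (h - y * e * S) * w.
  by ring.
rewrite -exprS -addSn.
by rewrite dvdp_sub ?dvdp_mulIl // dvdp_mulr.
Qed.

Let coef0_1X j : ((1 - 'X : {poly rat}) ^+ j)`_0 != 0.
Proof.
by rewrite -horner_coef0 horner_exp !hornerE ?subr0 expr1n oner_neq0.
Qed.

Let coef0_1qX : (1 - #|F|%:R * 'X : {poly rat})`_0 != 0.
Proof. by rewrite coefB coef1 coefMX eqxx subr0 oner_neq0. Qed.

Let coef0_nz (p : {poly rat}) : p`_0 != 0 -> p%:F != 0.
Proof. by rewrite tofrac_eq0; apply: contraNneq => ->; rewrite coef0. Qed.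

Let tofrac1X : 1 - 'X%:F = (1 - 'X : {poly rat})%:F.
Proof. by rewrite rmorphB rmorph1. Qed.

Let tofrac1qX :
  1 - #|F|%:R * 'X%:F = (1 - #|F|%:R * 'X : {poly rat})%:F.
Proof. by rewrite rmorphB rmorph1 rmorphM rmorph_nat. Qed.

Lemma zeta2_at_card_congr :
  fps_eqmod (n - d + 1)
    (ratfun_at_u (zeta2 C M) q * (1 - 'X%:F) ^+ (d + 1))
    (ratfun_subst a%:F ('X%:F / (1 - 'X%:F))).
Proof.
have X0 : (1 - 'X : {poly rat}) != 0.
  by rewrite -tofrac_eq0 coef0_nz // -(expr1 (1 - 'X)).
have X1 : 1 - 'X%:F != 0 :> ratfun1 by rewrite tofrac1X tofrac_eq0.
rewrite (zeta2_at_card C0 gM) -/P.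
have -> : ((1 - 'X) * (1 - #|F|%:R * 'X) : {poly rat})%:F =
    (1 - 'X%:F) * (1 - #|F|%:R * 'X : {poly rat})%:F.
  by rewrite rmorphM tofrac1X.
rewrite !addn1 (div_mul_cancel1 _ _ _ X1) tofrac1X.
rewrite ratfun_subst_poly (horner_homog size_norm_wt_enum X0).
rewrite -rmorphXn -rmorphM -fps_eqmodP //.
by rewrite -mulrA -exprD zeta_numerator_congr.
Qed.

Lemma zeta2_at_card_zeta1 : (forall j : 'I_n, col j M != 0) -> (0 < k)%N ->
  ratfun_at_u (zeta2 C M) q = zeta1 C.
Proof.
move=> cM k0.
have zE : P%:F / ((1 - 'X%:F) * (1 - #|F|%:R * 'X%:F)) =
    ratfun_at_u (zeta2 C M) q.
  rewrite (zeta2_at_card C0 gM) -/P; congr (_ / _).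
  by rewrite tofrac1qX tofrac1X [RHS]rmorphM.
have zP : is_zeta_poly C P.
  split; first exact: size_zeta_numerator.
  by have := zeta2_at_card_congr; rewrite -zE !addn1.
have [P' [_ uP]] := zeta_poly_exists_unique C.
have eP : zeta_poly C = P.
  by rewrite -(uP _ zP) (uP _ (svalP (cid (zeta_poly_exists C)))).
by rewrite /zeta1 eP zE.
Qed.

Lemma zeta2_at_card_subst :
  fps_eqmod (n - d + 1)
    (a%:F * (1 + 'X%:F) ^+ (d + 1))
    (ratfun_subst (ratfun_at_u (zeta2 C M) q) ('X%:F / (1 + 'X%:F))).
Proof.
set Y : {poly rat} := 1 + 'X.
set W : {poly rat} := Y - #|F|%:R * 'X.
pose c1 : rat := (q ^+ k.+1 - 1) / (q - 1).
pose c2 : rat := q * ((q ^+ k - 1) / (q - 1)).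
have Y0 : Y`_0 != 0 by rewrite coefD coef1 coefX addr0 oner_neq0.
have Yj j : (Y ^+ j)`_0 != 0.
  by rewrite -horner_coef0 horner_exp !hornerE ?addr0 expr1n oner_neq0.
have W0 : W`_0 != 0 by rewrite coefB coefMX subr0.
have YE : 1 + 'X%:F = Y%:F by rewrite rmorphD rmorph1.
have nzB (p : {poly rat}) : p`_0 != 0 -> p != 0.
  by move/coef0_nz; rewrite tofrac_eq0.
have YF : Y%:F != 0 by exact: coef0_nz.
have WF : W%:F != 0 by exact: coef0_nz.
have YmF : (Y ^+ m)%:F != 0 by exact: coef0_nz.
have WE : W%:F = Y%:F - ratfun1_const q * 'X%:F.
  by rewrite rmorphB rmorphM /= polyC_natr.
pose h : ratfun1 := 'X%:F / Y%:F.
pose ev p := (map_poly ratfun1_const p).[h].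
have evM p r : ev (p * r) = ev p * ev r by rewrite /ev rmorphM hornerM.
have evD p r : ev (p + r) = ev p + ev r by rewrite /ev rmorphD hornerD.
have evN p : ev (- p) = - ev p by rewrite /ev rmorphN hornerN.
have evX : ev 'X = h by rewrite /ev map_polyX hornerX.
have evXn j : ev 'X^j = h ^+ j by rewrite /ev map_polyXn hornerXn.
have evC c : ev c%:P = ratfun1_const c by rewrite /ev map_polyC hornerC.
have Sh : ev S = (homog m S Y)%:F / (Y ^+ m)%:F.
  by rewrite /ev (@horner_homog m S Y (size_poly _ _) (nzB _ Y0)).
pose b : ratfun1 := (1 - h) * (1 - ratfun1_const q * h).
have bE : ev ((1 - 'X) * (1 - #|F|%:R * 'X)) = b.
  rewrite -polyC_natr -[1]polyC1 evM !(evD, evN) evM evX !evC.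
  by rewrite (rmorph1 ratfun1_const).
have PE : ev P = (homog m S Y)%:F / (Y ^+ m)%:F * b +
  'X%:F ^+ m * h / (Y ^+ m)%:F * (ratfun1_const c1 - ratfun1_const c2 * h).
  rewrite /P /zeta_numerator -/q -/d -/m -/a -/S -/c1 -/c2.
  rewrite evD [ev (S * _)]evM bE Sh evM evXn evD evN evM evX !evC.
  congr (_ + _ * _).
  rewrite mulrAC exprSr; congr (_ * _).
  by rewrite /h expr_div_n [(Y ^+ m)%:F]rmorphXn.
have b0 : b != 0.
  exact (@subst_denominator_neq0 ratfun1 _ _ _ _ (esym YE) WE WF YF).
rewrite (zeta2_at_card C0 gM) -/P /ratfun_subst ratfun_evalE YE; last first.
  by rewrite -/h -/(ev _) bE.
rewrite -/h -!/(ev _) PE bE.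
have := @subst_field_identity ratfun1 (homog m S Y)%:F W%:F Y%:F 'X%:F
  (ratfun1_const q) (ratfun1_const c1) (ratfun1_const c2)
  ('X%:F ^+ m) (Y ^+ m)%:F b (esym YE) WE WF YF YmF erefl.
rewrite -/h => ->.
pose num := homog m S Y * W + 'X^(m.+1) * (c1%:P * Y - c2%:P * 'X).
have -> : (homog m S Y)%:F * W%:F + 'X%:F ^+ m * 'X%:F *
   (ratfun1_const c1 * Y%:F - ratfun1_const c2 * 'X%:F) = num%:F.
  rewrite -exprSr [RHS]rmorphD [X in _ = X + _]rmorphM; congr (_ + _).
  rewrite [RHS]rmorphM rmorphXn rmorphB; congr (_ * (_ - _)).
    by rewrite [RHS]rmorphM.
  by rewrite [RHS]rmorphM.
(* The polynomial side is given denominator 1, the form that [fps_eqmodP] expects. *)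
rewrite -rmorphM -rmorphXn -rmorphM -[X in fps_eqmod _ X]divr1.
rewrite -(rmorph1 (@tofrac {poly rat})).
rewrite -fps_eqmodP ?coef1 ?oner_neq0 //; last by rewrite coef0M mulf_neq0.
rewrite mulr1 /num addn1.
have := dvdp_homog_binom_transform d m a (y := 1) (z := Y).
rewrite addrC => /(_ erefl).
rewrite expr1n mul1r homog1 ?size_norm_wt_enum // -/S => dv.
have -> (e r s w u v p : {poly rat}) :
    p * u * (v * w) - (s * w + e * r) = (u * v * p - s) * w - e * r by ring.
rewrite -exprD addn1.
by rewrite dvdp_sub ?dvdp_mulIl // dvdp_mulr.
Qed.
End Final.

Theorem mainTheorem4 (F : finFieldType) (n k d : nat)
    (C : {vspace 'rV[F]_n}) (M : 'M[F]_(k, n))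
    (C_neq0 : C != 0%VS)
    (dimC : \dim C = k)
    (distC : min_distance C = d)
    (genM : is_generator_matrix C M) :
  let q : rat := #|F|%:R in
  let a : ratfun1 := (norm_wt_enum C)%:F in
  let Zq : ratfun1 := ratfun_at_u (zeta2 C M) q in
  let T : ratfun1 := 'X%:F in
  [/\ (* Z(T, q) = Z(T), if no coordinate is identically zero on C *)
      (forall j : 'I_n, col j M != 0) -> Zq = zeta1 C,
      (* a(t) (1 + t)^(d+1) = Z(t / (1 + t), q) (mod t^(n+1-d)) *)
      fps_eqmod (n + 1 - d)
        (a * (1 + T) ^+ (d + 1)) (ratfun_subst Zq (T / (1 + T))) &
      (* Z(T, q) (1 - T)^(d+1) = a(T / (1 - T)) (mod T^(n-d+1)) *)
      fps_eqmod (n - d + 1)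
        (Zq * (1 - T) ^+ (d + 1)) (ratfun_subst a (T / (1 - T)))].
Proof.
have k_gt0 : (0 < k)%N by rewrite -dimC lt0n dimv_eq0.
have le_dn : (d <= n)%N by rewrite -distC min_distance_le_length.
rewrite -distC in le_dn *; split.
- by move=> colM; exact (zeta2_at_card_zeta1 C_neq0 genM colM k_gt0).
- by rewrite addn1 subSn // -addn1; exact (zeta2_at_card_subst C_neq0 genM).
- exact (zeta2_at_card_congr C_neq0 genM).
Qed.
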